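(* Let $R$ be a reduced extended affine root system with extended affine Weyl group $\mathcal W$. If $P\subseteq R^\times$ satisfies $\mathcal W=\mathcal W_P$, then $\langle P\rangle=\langle R\rangle$ and $P$ is connected. In particular, if $P$ belongs to any of $\mathcal M_c$, $\mathcal M_m$ and $\mathcal M_r$, then $\langle P\rangle=\langle R\rangle$ and $P$ is connected.
   Context: All vector spaces are finite-dimensional and real. Let $\mathcal V$ be a vector space with a positive semidefinite symmetric bilinear form $(\cdot,\cdot)$ with radical $\mathcal V^0$. For $R\subseteq\mathcal V$ put $R^0=R\cap\mathcal V^0$, $R^\times=R\setminus R^0$. For $(\alpha,\alpha)\ne0$ put $\alpha^\vee=2\alpha/(\alpha,\alpha)$, $w_\alpha(\beta)=\beta-(\beta,\alpha^\vee)\alpha$. $\langle A\rangle$ is the additive subgroup generated by $A$. $P\subseteq\mathcal V\setminus\mathcal V^0$ is connected if it is not a disjoint union of nonempty $P_1,P_2$ with $(P_1,P_2)=\{0\}$. $R$ is an extended affine root system if: $\langle R\rangle$ is a full lattice in $\mathcal V$; $(\beta,\alpha^\vee)\in\mathbb Z$ for $\alpha,\beta\in R^\times$; $w_\alpha(\beta)\in R$ for $\alpha\in R^\times,\beta\in R$; $R^0=\mathcal V^0\cap(R^\times-R^\times)$; $\alpha\in R^\times\Rightarrow2\alpha\notin R$; $R^\times$ is connected. In particular $R^\times\ne\emptyset$. The image $\bar R$ of $R$ in $\mathcal V/\mathcal V^0$ is an irreducible finite root system (containing $0$); $R$ is reduced if $\bar R$ is. Weyl group: there is a finite root system $\dot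 R\subseteq R$ mapping isometrically onto $\bar R$ with $\mathcal V=\dot{\mathcal V}\oplus\mathcal V^0$, $\dot{\mathcal V}=\mathrm{span}\,\dot R$. Put $\tilde{\mathcal V}=\dot{\mathcal V}\oplus\mathcal V^0\oplus(\mathcal V^0)^*$ and extend the form by $(\dot{\mathcal V},(\mathcal V^0)^* )=((\mathcal V^0)^*,(\mathcal V^0)^* )=\{0\}$, $(\sigma,\lambda)=\lambda(\sigma)$. $\mathcal W\le GL(\tilde{\mathcal V})$ is generated by $w_\alpha:\beta\mapsto\beta-(\beta,\alpha^\vee)\alpha$, $\alpha\in R^\times$; $\mathcal W_P$ is the subgroup generated by $w_\alpha$, $\alpha\in P$. Classes: $\mathcal M_r$ is the class of reflectable bases, i.e. $P\subseteq R^\times$ with $\mathcal W_PP=R^\times$ such that no proper subset $P'$ of $P$ satisfies $\mathcal W_{P'}P'=R^\times$. $\mathcal M_m$ is the class of $P\subseteq R^\times$ minimal under inclusion with respect to $\mathcal W_P=\mathcal W$. $\mathcal M_c$ is the class of $P\subseteq R^\times$ with $\mathcal W_P=\mathcal W$ and $|P|=c$, where $c$ is the least number of reflections $w_\alpha$ ($\alpha\in R^\times$) generating $\mathcal W$. *)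

(* Defs.v *)
From HB Require Import structures.
From mathcomp Require Import all_boot all_order all_algebra sesquilinear.
From mathcomp Require Import finmap all_classical all_reals ring.

Set Implicit Arguments.
Unset Strict Implicit.
Unset Printing Implicit Defensive.

Import Order.TTheory GRing.Theory Num.Theory.

Local Open Scope classical_set_scope.
Local Open Scope ring_scope.

Definition radical (K : realType) (V : vectType K) (B : {symmetric V}) :
  {vspace V} := orthov B fullv.

Lemma radicalP (K : realType) (V : vectType K) (B : {symmetric V}) (v : V) :
  reflect (forall w, B v w = 0) (v \in radical B).
Proof.
apply: (iffP mem_orthovP) => h w; first by apply: h; rewrite memvf.
by move=> _; apply: h.
Qed.

(* [iso_part B R] is R^0 and [aniso_part B R] is R^x. *)
Definition iso_part (K : realType) (V : vectType K) (B : {symmetric V})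
  (R : set V) : set V := R `&` [set v | v \in radical B].

Definition aniso_part (K : realType) (V : vectType K) (B : {symmetric V})
  (R : set V) : set V := R `\` iso_part B R.

Definition additive_subgroup (V : zmodType) (H : set V) : Prop :=
  H 0 /\ forall x y, H x -> H y -> H (x - y).

Definition zspan (V : zmodType) (A : set V) : set V :=
  smallest (@additive_subgroup V) A.

Definition full_lattice (K : realType) (V : vectType K) (L : set V) : Prop :=
  exists2 b : seq V, basis_of fullv b & L = zspan [set v | v \in b].

Definition coroot (K : realType) (V : vectType K) (f : V -> V -> K) (a : V) :
  V := (2 / f a a) *: a.

Definition reflection (K : realType) (V : vectType K) (f : V -> V -> K)
  (a b : V) : V := b - f b (coroot f a) *: a.

Definition connected_roots (K : realType) (V : vectType K) (f : V -> V -> K)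
  (P : set V) : Prop :=
  ~ exists P1 P2 : set V,
      [/\ P1 !=set0, P2 !=set0, P = P1 `|` P2, P1 `&` P2 = set0 &
          forall a b, P1 a -> P2 b -> f a b = 0].

(* The form is only required to be an inner product on the span of [S], and
   0 is counted as an element of a root system. *)
Definition finite_root_system (K : realType) (V : vectType K)
  (f : V -> V -> K) (S : set V) : Prop :=
  [/\ finite_set S,
      S 0,
      forall v, v \in <<fset_set S>>%VS -> v != 0 -> 0 < f v v,
      forall a b, S a -> a != 0 -> S b -> f b (coroot f a) \is a Num.int &
      forall a b, S a -> a != 0 -> S b -> S (reflection f a b)].

Definition reduced_root_system (K : realType) (V : vectType K) (S : set V) :
  Prop :=
  forall (a : V) (c : K), S a -> a != 0 -> S (c *: a) -> c *: a != 0 ->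
    c = 1 \/ c = -1.

Record extended_affine_root_system (K : realType) (V : vectType K)
    (B : {symmetric V}) (R : set V) : Prop := {
  ears_lattice : full_lattice (zspan R);
  ears_int : forall a b, aniso_part B R a -> aniso_part B R b ->
    B b (coroot B a) \is a Num.int;
  ears_refl : forall a b, aniso_part B R a -> R b -> R (reflection B a b);
  ears_iso : iso_part B R = [set v | v \in radical B] `&`
    [set a - b | a in aniso_part B R & b in aniso_part B R];
  ears_double : forall a, aniso_part B R a -> ~ R (2 *: a);
  ears_connected : connected_roots B (aniso_part B R);
  ears_nonempty : aniso_part B R !=set0
}.

(* The quotient of V by the radical, realised on a chosen linear complement of
   the radical; the quotient map is the projection along the radical (see
   [lker_quot_proj] and [limg_quot_proj]). *)
Definition quot (K : realType) (V : vectType K) (B : {symmetric V}) :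
  vectType K := subvs_of (radical B)^C%VS.

Definition quot_proj (K : realType) (V : vectType K) (B : {symmetric V}) :
  'Hom(V, quot B) :=
  (linfun (vsproj (radical B)^C) \o daddv_pi (radical B)^C (radical B))%VF.

Definition quot_form (K : realType) (V : vectType K) (B : {symmetric V})
  (u v : quot B) : K := B (vsval u) (vsval v).

Lemma vsval_quot_proj (K : realType) (V : vectType K) (B : {symmetric V})
  (v : V) : v - vsval (quot_proj B v) \in radical B.
Proof.
rewrite comp_lfunE lfunE /= vsprojK ?memv_pi//.
have h : ((radical B)^C :&: radical B = 0)%VS by rewrite capvC capv_compl.
have := daddv_pi_add h (w := v).
rewrite addvC addv_complf memvf => /(_ isT) {1}<-.
by rewrite addrAC subrr add0r memv_pi.
Qed.

Lemma quot_formE (K : realType) (V : vectType K) (B : {symmetric V})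
  (u v : V) : quot_form (quot_proj B u) (quot_proj B v) = B u v.
Proof.
have hu := vsval_quot_proj B u; have hv := vsval_quot_proj B v.
rewrite /quot_form; set u' := vsval _ in hu *; set v' := vsval _ in hv *.
have e1 : B u v = B u' v.
  by apply/eqP; rewrite -subr_eq0 -linearBl /=; move/radicalP: hu => ->.
have e2 : B v u' = B v' u'.
  by apply/eqP; rewrite -subr_eq0 -linearBl /=; move/radicalP: hv => ->.
by rewrite e1 [B u' v]hermC e2 [B u' v']hermC.
Qed.

Lemma lker_quot_proj (K : realType) (V : vectType K) (B : {symmetric V}) :
  lker (quot_proj B) = radical B.
Proof.
apply/vspaceP => v; rewrite memv_ker; apply/eqP/idP => [v0|vr].
  have := vsval_quot_proj B v; rewrite v0.
  by have -> : vsval (0 : quot B) = 0 by []; rewrite subr0.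
have h := rpredB vr (vsval_quot_proj B v); rewrite opprB addrC subrK in h.
apply/eqP; rewrite -(inj_eq val_inj) linear0 -memv0 -(capv_compl (radical B)).
by rewrite memv_cap h; apply: subvsP.
Qed.

Lemma limg_quot_proj (K : realType) (V : vectType K) (B : {symmetric V}) :
  limg (quot_proj B) = fullv.
Proof.
apply/vspaceP => u; rewrite memvf; apply/memv_imgP.
exists (vsval u); rewrite ?memvf// comp_lfunE lfunE /=.
rewrite daddv_pi_id ?vsvalK ?subvsP//.
by rewrite capvC capv_compl.
Qed.

Definition quot_roots (K : realType) (V : vectType K) (B : {symmetric V})
  (R : set V) : set (quot B) := quot_proj B @` R.
Arguments quot_roots {K V} B R.

Definition reduced_ears (K : realType) (V : vectType K) (B : {symmetric V})
  (R : set V) : Prop := reduced_root_system (quot_roots B R).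

Record finite_lift (K : realType) (V : vectType K) (B : {symmetric V})
    (R S : set V) : Prop := {
  lift_root_system : finite_root_system B S;
  lift_sub : S `<=` R;
  lift_bij : set_bij S (quot_roots B R) (quot_proj B);
  lift_isometry : forall a b, S a -> S b ->
    quot_form (quot_proj B a) (quot_proj B b) = B a b;
  lift_direct : directv (<<fset_set S>> + radical B);
  lift_full : (<<fset_set S>> + radical B)%VS = fullv
}.

(* V = Vdot (+) V^0 is kept as an internal direct sum, so that the hyperbolic
   extension is V x (V^0)^*, with V embedded by [ext_embed]. *)
Definition ext_space (K : realType) (V : vectType K) (B : {symmetric V}) :
  vectType K := (V * 'Hom(subvs_of (radical B), K^o))%type.

Definition ext_embed (K : realType) (V : vectType K) (B : {symmetric V})
  (v : V) : ext_space B := (v, 0).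

(* The V^0-component of [v] in V = Vdot (+) V^0. *)
Definition radical_part (K : realType) (V : vectType K) (B : {symmetric V})
  (D : {vspace V}) (v : V) : subvs_of (radical B) :=
  vsproj (radical B) (daddv_pi (radical B) D v).

Lemma radical_part_id (K : realType) (V : vectType K) (B : {symmetric V})
  (D : {vspace V}) (s : subvs_of (radical B)) :
  directv (D + radical B) -> radical_part B D (vsval s) = s.
Proof.
move=> /directv_addP DB; rewrite /radical_part daddv_pi_id ?vsvalK ?subvsP//.
by rewrite capvC.
Qed.

Lemma radical_part0 (K : realType) (V : vectType K) (B : {symmetric V})
  (D : {vspace V}) (v : V) :
  directv (D + radical B) -> v \in D -> radical_part B D v = 0.
Proof.
move=> /directv_addP DB vD; rewrite /radical_part.
have := daddv_pi_add DB (w := v) (subvP (addvSl _ _) _ vD).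
rewrite daddv_pi_id// => /(canRL (addKr _)); rewrite addNr => ->.
exact: linear0.
Qed.

Definition ext_form (K : realType) (V : vectType K) (B : {symmetric V})
  (D : {vspace V}) (x y : ext_space B) : K :=
  B x.1 y.1 + x.2 (radical_part B D y.1) + y.2 (radical_part B D x.1).

Definition ext_reflection (K : realType) (V : vectType K) (B : {symmetric V})
  (D : {vspace V}) (a : V) : 'End(ext_space B) :=
  linfun (reflection (@ext_form K V B D) (ext_embed B a)).

Lemma ext_reflectionE (K : realType) (V : vectType K) (B : {symmetric V})
  (D : {vspace V}) (a : V) (x : ext_space B) :
  ext_reflection B D a x =
  reflection (@ext_form K V B D) (ext_embed B a) x.
Proof.
have lin : linear (reflection (@ext_form K V B D) (ext_embed B a)).
  move=> c u v; rewrite /reflection; set w := coroot _ _.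
  have -> : ext_form D (c *: u + v) w = c * ext_form D u w + ext_form D v w.
    clearbody w; rewrite /ext_form /radical_part.
    have -> : B (c *: u + v).1 w.1 = c * B u.1 w.1 + B v.1 w.1.
      exact: linearPl.
    have -> : forall s, (c *: u + v).2 s = c * u.2 s + v.2 s.
      by move=> s; rewrite /= add_lfunE scale_lfunE.
    have -> : w.2 (vsproj (radical B) (daddv_pi (radical B) D (c *: u + v).1))
      = c * w.2 (vsproj (radical B) (daddv_pi (radical B) D u.1))
        + w.2 (vsproj (radical B) (daddv_pi (radical B) D v.1)).
      by rewrite /= !linearP.
    ring.
  by rewrite scalerDl opprD scalerBr -scalerA addrACA.
pose f := GRing.isLinear.Build K (ext_space B) (ext_space B) *:%R _ lin.
pose g : {linear ext_space B -> ext_space B} := HB.pack (reflection (@ext_form K V B D) (ext_embed B a)) f.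
exact: (lfunE g).
Qed.

Definition linear_subgroup (K : realType) (U : vectType K)
  (G : set 'End(U)) : Prop :=
  [/\ forall g, G g -> lker g = 0%VS,
      G \1%VF,
      forall g h, G g -> G h -> G (g \o h)%VF &
      forall g, G g -> G (g^-1)%VF].

Definition generated_group (K : realType) (U : vectType K)
  (A : set 'End(U)) : set 'End(U) := smallest (@linear_subgroup K U) A.

(* [S] is a finite root system lifting the quotient root system of [R]; the
   extended form, hence also the group, depends on it. *)
Definition weyl_group (K : realType) (V : vectType K) (B : {symmetric V})
  (S P : set V) : set 'End(ext_space B) :=
  generated_group (ext_reflection B <<fset_set S>>%VS @` P).
Arguments weyl_group {K V} B S P.

Definition generates_weyl (K : realType) (V : vectType K) (B : {symmetric V})
  (R S P : set V) : Prop :=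
  weyl_group B S P = weyl_group B S (aniso_part B R).

Definition weyl_orbit (K : realType) (V : vectType K) (B : {symmetric V})
  (S P : set V) : set (ext_space B) :=
  [set w (ext_embed B p) | w in weyl_group B S P & p in P].
Arguments weyl_orbit {K V} B S P.

Definition reflectable_base (K : realType) (V : vectType K)
  (B : {symmetric V}) (R S P : set V) : Prop :=
  [/\ P `<=` aniso_part B R,
      weyl_orbit B S P = ext_embed B @` aniso_part B R &
      forall P', P' `<` P ->
        weyl_orbit B S P' <> ext_embed B @` aniso_part B R].

Definition minimal_generating (K : realType) (V : vectType K)
  (B : {symmetric V}) (R S P : set V) : Prop :=
  [/\ P `<=` aniso_part B R,
      generates_weyl B R S P &
      forall P', P' `<` P -> ~ generates_weyl B R S P'].

Definition generated_by_reflections (K : realType) (V : vectType K)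
  (B : {symmetric V}) (R S : set V) (n : nat) : Prop :=
  exists A : set 'End(ext_space B),
    [/\ A `<=` ext_reflection B <<fset_set S>>%VS @` aniso_part B R,
        (A #= `I_n)%card &
        generated_group A = weyl_group B S (aniso_part B R)].

Definition least_reflection_number (K : realType) (V : vectType K)
  (B : {symmetric V}) (R S : set V) (c : nat) : Prop :=
  generated_by_reflections B R S c /\
  forall n, generated_by_reflections B R S n -> (c <= n)%N.

Definition minimum_generating (K : realType) (V : vectType K)
  (B : {symmetric V}) (R S P : set V) : Prop :=
  [/\ P `<=` aniso_part B R,
      generates_weyl B R S P &
      exists2 c, least_reflection_number B R S c & (P #= `I_c)%card].

(* Main.v *)
Require Import Defs.
From HB Require Import structures.
From mathcomp Require Import all_boot all_order all_algebra sesquilinear.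
From mathcomp Require Import finmap all_classical all_reals ring lra zify.

Set Implicit Arguments.
Unset Strict Implicit.
Unset Printing Implicit Defensive.

Import Order.TTheory GRing.Theory Num.Theory.

Local Open Scope classical_set_scope.
Local Open Scope ring_scope.

(** Why the theorem holds.

Fix an anisotropic root [a] and suppose that W_P = W. The extended affine Weyl
group acts on V, and on V the group W_P can only move a vector x by integral
combinations of elements of P as soon as (x, p^v) is an integer for all p in P.
If moreover (x, a^v) = 1, then w_a lies in W_P and w_a x = x - a, so [a] is in
the lattice spanned by P ([generating_zspan]). Since the isotropic roots are
differences of anisotropic ones, P spans the same lattice as R.

Such an x is a weight of the finite quotient root system, and its existence
says that coroots are primitive in the coroot lattice; this is where
reducedness enters. In a reduced system it follows from the fact that each root
belongs to a base, but bases can be avoided ([finite_root_weight]).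
If (b, a^v) is odd for some root b, then some b - q a has pairing 1 with a^v.
Otherwise [a] is what is called below an even root. Any two even roots are
equal, opposite or orthogonal, so up to signs they form an orthogonal frame
(the short roots of a system of type B), which the reflections permute. Half the
sum of this frame is the wanted weight: it generalises the spin weight of B_n
([even_root_weight]).

For connectedness, let P be the union of two orthogonal parts P1 and P2. Both
the orthogonal of P1 and its biorthogonal are stable under the reflections in P,
hence under W_P. Each anisotropic root [a] lies in one of these two spaces: if
W_P = W and [a] is not orthogonal to p in P1, then w_a p lies in the
biorthogonal of P1 together with p, and hence so does [a]. This splits the
anisotropic roots of R into two orthogonal parts, which are not empty when P1
and P2 are not, against the connectedness of R ([connected_of_dichotomy]).

Elements of the first two classes generate W by definition. For a reflectable
base both conclusions are even more direct, since each anisotropic root is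
w p with p in P and w in W_P, and the same stable sets apply. *)

(** * The form, coroots and reflections *)

Lemma bformC (K : realType) (V : vectType K) (B : {symmetric V}) (u v : V) :
  B u v = B v u.
Proof. by rewrite hermC expr0 mul1r. Qed.

Lemma bformZr (K : realType) (V : vectType K) (B : {symmetric V}) (c : K)
  (u v : V) : B u (c *: v) = c * B u v.
Proof. exact: linearZr_LR. Qed.

Lemma bformZl (K : realType) (V : vectType K) (B : {symmetric V}) (c : K)
  (u v : V) : B (c *: u) v = c * B u v.
Proof. exact: linearZl_LR. Qed.

Lemma bformNr (K : realType) (V : vectType K) (B : {symmetric V}) (u v : V) :
  B u (- v) = - B u v.
Proof. exact: linearNr. Qed.

Lemma bformNl (K : realType) (V : vectType K) (B : {symmetric V}) (u v : V) :
  B (- u) v = - B u v.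
Proof. exact: linearNl. Qed.

Lemma form_coroot (K : realType) (V : vectType K) (B : {symmetric V})
  (a b : V) : B b (coroot B a) = 2 * B b a / B a a.
Proof. by rewrite bformZr mulrAC. Qed.

Lemma form_coroot_id (K : realType) (V : vectType K) (B : {symmetric V})
  (a : V) : B a a != 0 -> B a (coroot B a) = 2.
Proof. by move=> a0; rewrite form_coroot mulfK. Qed.

Lemma form_coroot_eq0 (K : realType) (V : vectType K) (B : {symmetric V})
  (a b : V) : B a a != 0 -> B b (coroot B a) = 0 -> B b a = 0.
Proof.
move=> a0 /eqP; rewrite form_coroot !mulf_eq0 invr_eq0 (negPf a0) pnatr_eq0.
by rewrite orbF => /eqP.
Qed.

(** Reflections are isometries, hence self-adjoint involutions and compatible
    with coroots; a pairing with a reflected coroot can be moved to the left. *)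
Lemma reflection_coroot (K : realType) (V : vectType K) (B : {symmetric V})
  (a u v : V) : B a a != 0 ->
  B u (coroot B (reflection B a v)) = B (reflection B a u) (coroot B v).
Proof.
move=> a0; rewrite !form_coroot /reflection !form_coroot.
rewrite !(linearBl, linearBr) /= !(bformZl, bformZr) (bformC B a v).
rewrite [X in _ / X](_ : _ = B v v); last by field.
by congr (_ / _); field.
Qed.

Lemma finite_root_system_gt0 (K : realType) (V : vectType K) (B : {symmetric V})
  (S : set V) (a : V) : finite_root_system B S -> S a -> a != 0 -> 0 < B a a.
Proof.
move=> [Sfin _ Spos _ _] Sa; apply: Spos.
by apply: memv_span; rewrite in_fset_set// inE.
Qed.

(** * Weights of finite reduced root systems *)

(** Among the irreducible reduced systems, these roots are those of A_1 and the
    short roots of B_n. *)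
Definition even_root (K : realType) (V : vectType K) (B : {symmetric V})
  (S : set V) (a : V) : Prop :=
  [/\ S a, a != 0 & forall b, S b -> B b (coroot B a) / 2 \is a Num.int].

Lemma even_rootN (K : realType) (V : vectType K) (B : {symmetric V})
  (S : set V) (a : V) : finite_root_system B S ->
  even_root B S a -> even_root B S (- a).
Proof.
move=> hS [Sa a0 ha]; have aa := finite_root_system_gt0 hS Sa a0.
have [_ _ _ _ Srefl] := hS; split; rewrite ?oppr_eq0//.
  have := Srefl _ _ Sa a0 Sa.
  rewrite /reflection form_coroot_id ?lt0r_neq0// scaler_nat mulr2n.
  by rewrite opprD addrA subrr sub0r.
move=> b /ha; rewrite !form_coroot !(bformNr, bformNl) opprK.
by rewrite mulrN !mulNr rpredN.
Qed.

Lemma even_root_reflection (K : realType) (V : vectType K) (B : {symmetric V})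
  (S : set V) (a b : V) : finite_root_system B S ->
  S b -> b != 0 -> even_root B S a -> even_root B S (reflection B b a).
Proof.
move=> hS Sb b0 [Sa a0 ha]; have bb := finite_root_system_gt0 hS Sb b0.
have [_ _ _ _ Srefl] := hS; split; first exact: Srefl.
  apply: contraNneq a0 => r0.
  have ab : B a (coroot B b) = 0.
    have /eqP : B (reflection B b a) (coroot B b) = 0 by rewrite r0 linear0l.
    rewrite /reflection linearBl /= bformZl form_coroot_id ?lt0r_neq0//.
    by rewrite subr_eq0 => /eqP; lra.
  by move: r0; rewrite /reflection ab scale0r subr0 => ->.
move=> c Sc; rewrite reflection_coroot ?lt0r_neq0//.
by apply: ha; apply: Srefl.
Qed.

(** With (g, d^v) = 2k and (d, g^v) = 2l, the vector g - k d has norm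
    (g, g)(1 - kl), and kl is not negative. Positivity leaves kl = 0, when the
    roots are orthogonal, or kl = 1, when g = k d with k = 1 or -1. *)
Lemma even_root_dichotomy (K : realType) (V : vectType K) (B : {symmetric V})
  (S : set V) (g d : V) :
  finite_root_system B S -> even_root B S g -> even_root B S d ->
  [\/ B g (coroot B d) = 0, g = d | g = - d].
Proof.
move=> hS [Sg g0 hg] [Sd d0 hd].
have gg := finite_root_system_gt0 hS Sg g0.
have dd := finite_root_system_gt0 hS Sd d0.
have /intrP[k ek] := hd _ Sg; have /intrP[l el] := hg _ Sd.
have [_ _ Spos _ _] := hS.
have inS x : S x -> x \in <<fset_set S>>%VS.
  by move=> Sx; apply: memv_span; rewrite in_fset_set ?inE//; case: hS.
have ek' : B g d = k%:~R * B d d.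
  by rewrite -ek form_coroot; field; rewrite lt0r_neq0.
have el' : B g d = l%:~R * B g g.
  by rewrite -el form_coroot (bformC B d); field; rewrite lt0r_neq0.
have norm : B (g - k%:~R *: d) (g - k%:~R *: d) = B g g * (1 - (k * l)%:~R).
  rewrite !(linearBl, linearBr) /= !(bformZl, bformZr) (bformC B d g).
  by rewrite -ek' subrr subr0 el' intrM; ring.
have [gkd|gkd] := eqVneq (g - k%:~R *: d) 0; last first.
  constructor 1; have /Spos/(_ gkd) : g - k%:~R *: d \in <<fset_set S>>%VS.
    by rewrite rpredB ?rpredZ ?inS.
  rewrite norm pmulr_rgt0// subr_gt0 (_ : 1 = 1%:~R)// ltr_int => kl1.
  have kl0 : 0 <= k * l.
    rewrite -(ler_int K) intrM -(pmulr_lge0 _ (mulr_gt0 gg dd)).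
    have -> : k%:~R * l%:~R * (B g g * B d d) = B g d ^+ 2.
      by rewrite expr2 {1}ek' el'; ring.
    exact: sqr_ge0.
  have : k * l == 0 by lia.
  rewrite mulf_eq0 form_coroot => /orP[]/eqP z.
    by rewrite ek' z mul0r mulr0 mul0r.
  by rewrite el' z mul0r mulr0 mul0r.
have e : g = k%:~R *: d by apply/eqP; rewrite -subr_eq0 gkd.
have : k * l == 1.
  move/eqP: norm; rewrite gkd linear0l eq_sym mulf_eq0 gt_eqF//= subr_eq0.
  by rewrite eq_sym (_ : 1 = 1%:~R)// eqr_int.
move=> /eqP/(congr1 absz)/eqP; rewrite abszM muln_eq1 => /andP[/eqP k1 _].
have : (k == 1) || (k == -1) by lia.
by case/orP=> /eqP z; [constructor 2|constructor 3];
  rewrite e z ?scale1r ?scaleN1r.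
Qed.

Lemma oppv_neq (K : realType) (V : vectType K) (v : V) : v != 0 -> - v != v.
Proof.
apply: contraNneq => e; have : 2 *: v = 0.
  by rewrite scaler_nat mulr2n -{1}e addNr.
by move/eqP; rewrite scaler_eq0 pnatr_eq0.
Qed.

(** The list [h] picks one root from each pair of opposite even roots. By
    [even_root_dichotomy] it is an orthogonal frame. *)
Lemma even_root_half (K : realType) (V : vectType K) (B : {symmetric V})
  (S : set V) : finite_root_system B S ->
  exists h : seq V, [/\ uniq h, forall g, g \in h -> even_root B S g,
    forall g, g \in h -> - g \notin h &
    forall g, even_root B S g -> (g \in h) || (- g \in h)].
Proof.
move=> hS; have [/finite_seqP[s es] _ _ _ _] := hS.
(* The canonical choice from a predicate depends on its extension only, so
   that g and - g have the same representative. *)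
pose rep (g : V) := choose (pred2 g (- g)) g.
have repN g : rep (- g) = rep g.
  rewrite /rep (@eq_choose _ (pred2 (- g) (- - g)) (pred2 g (- g))).
    by apply: choose_id; rewrite /= eqxx ?orbT.
  by move=> x /=; rewrite opprK orbC.
have inh g : (g \in [seq g <- undup s | `[< even_root B S g >] && (rep g == g)])
    = `[< even_root B S g >] && (rep g == g).
  rewrite mem_filter mem_undup andb_idr// => /andP[/asboolP[Sg _ _] _].
  by move: Sg; rewrite es.
exists [seq g <- undup s | `[< even_root B S g >] && (rep g == g)]; split.
- exact/filter_uniq/undup_uniq.
- by move=> g; rewrite inh => /andP[/asboolP].
- move=> g; rewrite !inh repN => /andP[/asboolP[_ g0 _] /eqP ->].
  by rewrite negb_and [g == _]eq_sym oppv_neq ?orbT.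
- move=> g eg; rewrite !inh repN !asboolT//=; last exact: even_rootN.
  have : pred2 g (- g) (rep g) by apply: chooseP; rewrite /= eqxx.
  by [].
Qed.

(** As (a, a^v) = 2, an odd pairing (b, a^v) can be brought to 1 by subtracting
    a multiple of [a] from [b]. *)
Lemma odd_root_weight (K : realType) (V : vectType K) (B : {symmetric V})
  (S : set V) (a : V) : finite_root_system B S -> S a -> a != 0 ->
  ~ even_root B S a ->
  exists2 x, B x (coroot B a) = 1 &
    forall b, S b -> b != 0 -> B x (coroot B b) \is a Num.int.
Proof.
move=> hS Sa a0 odda; have aa := finite_root_system_gt0 hS Sa a0.
have [_ _ _ Sint _] := hS.
have [b Sb oddb] : exists2 b, S b & ~ (B b (coroot B a) / 2 \is a Num.int).
  apply: contra_notP odda => no; split=> // b Sb.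
  by apply: contra_notP no => nb; exists b.
have /intrP[m em] := Sint _ _ Sa a0 Sb.
exists (b - (m %/ 2)%Z%:~R *: a) => [|c Sc c0]; last first.
  by rewrite linearBl /= bformZl rpredB ?rpredM ?Sint// intr_int.
rewrite linearBl /= bformZl form_coroot_id ?lt0r_neq0// em.
have [m0|m1] : (m %% 2)%Z = 0 \/ (m %% 2)%Z = 1 by lia.
  case: oddb; rewrite em {1}(divz_eq m 2) m0 addr0 intrM.
  by rewrite mulfK ?intr_eq0 ?intr_int.
by rewrite {1}(divz_eq m 2) m1 intrD intrM addrAC subrr add0r.
Qed.

(** The weight is x, half the sum of the frame of [even_root_half]. It pairs to
    1 with each coroot of the frame. For a root b that is not even, the
    reflection in b maps each member g of the frame, up to sign, to a member d; if g is not
    orthogonal to b then b is proportional to g - w_b g, so that all members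
    other than g and d are orthogonal to b, and g and d contribute
    opposite or equal terms to 2 (x, b^v). *)
Lemma even_root_weight (K : realType) (V : vectType K) (B : {symmetric V})
  (S : set V) (a : V) : finite_root_system B S -> reduced_root_system S ->
  even_root B S a ->
  exists2 x, B x (coroot B a) = 1 &
    forall b, S b -> b != 0 -> B x (coroot B b) \is a Num.int.
Proof.
move=> hS Sred ea; have [h [hu he hN hh]] := even_root_half hS.
have [_ _ _ Sint _] := hS.
pose x := \sum_(g <- h) (2^-1 *: g).
have xE y : B x (coroot B y) = \sum_(g <- h) (B g (coroot B y) / 2).
  rewrite bformC linear_sum /=; apply: eq_bigr => g _.
  by rewrite bformZr bformC mulrC.
have xa g : g \in h -> B x (coroot B g) = 1.
  move=> gh; have eg := he _ gh; have [Sg g0 _] := eg.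
  rewrite xE (bigD1_seq g)//= form_coroot_id.
    rewrite divff ?pnatr_eq0// big_seq_cond big1 ?addr0// => d /andP[dh dg].
    have [->|e|e] := even_root_dichotomy hS (he _ dh) eg.
    - by rewrite mul0r.
    - by rewrite e eqxx in dg.
    - by have := hN _ gh; rewrite -e dh.
  by rewrite gt_eqF// (finite_root_system_gt0 hS Sg).
have xint b : S b -> b != 0 -> B x (coroot B b) \is a Num.int.
  move=> Sb b0; rewrite xE.
  have bb := lt0r_neq0 (finite_root_system_gt0 hS Sb b0).
  have [eb|nb] := pselect (even_root B S b).
    rewrite big_seq; apply: rpred_sum => g /he[Sg _ _].
    by have [_ _] := eb; apply.
  have [no|] := pselect (forall g, g \in h -> B g (coroot B b) = 0).
    by rewrite big_seq big1 ?rpred0// => g /no->; rewrite mul0r.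
  move=> /existsNP[g /not_implyP[gh /eqP gb0]].
  have eg := he _ gh; have [Sg g0 _] := eg.
  have er := even_root_reflection hS Sb b0 eg.
  set r := reflection B b g in er.
  have rb : B r (coroot B b) = - B g (coroot B b).
    rewrite /r /reflection linearBl /= bformZl form_coroot_id//; ring.
  have gr : g - r = B g (coroot B b) *: b.
    by rewrite /r /reflection opprB addrCA subrr addr0.
  (* If w_b g = - g, then g is proportional to b; in a reduced system b
     would be g or - g, hence even. *)
  have rNg : r != - g.
    apply/eqP => e; have gcb : g = (B g (coroot B b) / 2) *: b.
      by rewrite mulrC -scalerA -gr e opprK -[in RHS](mulr2n g) -scaler_nat
        scalerA mulVf ?pnatr_eq0// scale1r.
    have := Sred _ (B g (coroot B b) / 2) Sb b0; rewrite -gcb.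
    case=> // c; rewrite c ?scale1r ?scaleN1r in gcb.
      by apply: nb; rewrite -gcb.
    by apply: nb; rewrite -[b]opprK -gcb; apply: even_rootN.
  have rg : r != g.
    by rewrite -subr_eq0 -opprB oppr_eq0 gr scaler_eq0 negb_or gb0.
  have [d dh dE] : exists2 d, d \in h & d = r \/ d = - r.
    by case/orP: (hh _ er) => ?; [exists r|exists (- r)]; auto.
  have dg : d != g.
    by case: dE => ->//; rewrite eqr_oppLR.
  rewrite (bigD1_seq g)//= -big_filter.
  rewrite (bigD1_seq d) ?filter_uniq//=; last first.
    by rewrite mem_filter dg.
  rewrite big_filter_cond big_seq_cond big1 => [|f /andP[fh /andP[fg fd]]].
    have bint := Sint _ _ Sb b0 Sg.
    rewrite addr0; case: dE => ->; rewrite ?bformNl rb.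
      by rewrite mulNr subrr rpred0.
    by rewrite opprK -splitr.
  have ef := he _ fh.
  have fg0 : B f g = 0.
    have [e|e|e] := even_root_dichotomy hS ef eg.
    - by apply: form_coroot_eq0 e;
        rewrite gt_eqF// (finite_root_system_gt0 hS Sg).
    - by rewrite e eqxx in fg.
    - by have := hN _ gh; rewrite -e fh.
  have [Sd d0 _] := he _ dh.
  have fd0 : B f d = 0.
    have [e|e|e] := even_root_dichotomy hS ef (he _ dh).
    - by apply: form_coroot_eq0 e;
        rewrite gt_eqF// (finite_root_system_gt0 hS Sd).
    - by rewrite e eqxx in fd.
    - by have := hN _ dh; rewrite -e fh.
  have fr0 : B f r = 0.
    by case: dE fd0 => ->//; rewrite bformNr => /eqP; rewrite oppr_eq0 => /eqP.
  have : B f (g - r) = 0 by rewrite linearBr /= fg0 fr0 subrr.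
  rewrite gr bformZr => /eqP; rewrite mulf_eq0 (negPf gb0)/= => /eqP fb0.
  by rewrite form_coroot fb0 mulr0 !mul0r.
have [ah|ah] := orP (hh _ ea); first by exists x; rewrite ?xa.
exists (- x) => [|b Sb b0].
  by rewrite -(xa _ ah) !form_coroot !(bformNr, bformNl) opprK.
by rewrite bformNl rpredN xint.
Qed.

(** In a reduced finite root system a coroot takes the value 1 on some weight,
    that is, it is primitive in the coroot lattice. *)
Lemma finite_root_weight (K : realType) (V : vectType K) (B : {symmetric V})
  (S : set V) (a : V) : finite_root_system B S -> reduced_root_system S ->
  S a -> a != 0 ->
  exists2 x, B x (coroot B a) = 1 &
    forall b, S b -> b != 0 -> B x (coroot B b) \is a Num.int.
Proof.
move=> hS Sred Sa a0; have [ea|oa] := pselect (even_root B S a).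
  exact: even_root_weight.
exact: odd_root_weight.
Qed.

(** * Anisotropic roots over the finite quotient *)

Lemma lift_reduced (K : realType) (V : vectType K) (B : {symmetric V})
  (R S : set V) : finite_lift B R S -> reduced_ears B R ->
  reduced_root_system S.
Proof.
move=> L Rred a c Sa a0 Sca ca0.
have [_ S0 _ _ _] := lift_root_system L.
have inj := set_bij_inj (lift_bij L).
have q0 s : S s -> s != 0 -> quot_proj B s != 0.
  by move=> Ss; apply: contraNneq; rewrite -(linear0 (quot_proj B)) => /inj->;
    rewrite ?inE.
have qR s : S s -> quot_roots B R (quot_proj B s).
  by move=> Ss; apply: (set_bij_homo (lift_bij L)).
have := Rred (quot_proj B a) c (qR _ Sa) (q0 _ Sa a0).
by rewrite -linearZ; apply; [exact: qR | exact: q0].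
Qed.

(** This is how statements about the finite system [S] reach [R]: the form does
    not see the difference of a root and its representative in [S]. *)
Lemma lift_aniso (K : realType) (V : vectType K) (B : {symmetric V})
  (R S : set V) (a : V) : finite_lift B R S -> aniso_part B R a ->
  exists s, [/\ S s, s != 0 & a - s \in radical B].
Proof.
move=> L [Ra na].
have [s Ss sa] := set_bij_surj (lift_bij L) (imageP (quot_proj B) Ra).
exists s; split=> //.
  apply: contra_notN na => /eqP s0; split=> //=.
  by rewrite -lker_quot_proj memv_ker -sa s0 linear0.
by rewrite -lker_quot_proj memv_ker linearB /= sa subrr.
Qed.

Lemma form_radical_eq (K : realType) (V : vectType K) (B : {symmetric V})
  (u a b : V) : a - b \in radical B -> B u a = B u b.
Proof.
move=> /radicalP/(_ u) ab; apply/eqP.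
by rewrite !(bformC B u) -subr_eq0 -linearBl /= ab.
Qed.

Lemma coroot_radical_eq (K : realType) (V : vectType K) (B : {symmetric V})
  (u a b : V) : a - b \in radical B -> B u (coroot B a) = B u (coroot B b).
Proof.
move=> ab; rewrite !form_coroot !(form_radical_eq _ ab) (bformC B a b).
by rewrite (form_radical_eq _ ab).
Qed.

Lemma aniso_neq0 (K : realType) (V : vectType K) (B : {symmetric V})
  (R S : set V) (a : V) : finite_lift B R S -> aniso_part B R a -> B a a != 0.
Proof.
move=> L /(lift_aniso L)[s [Ss s0 as_rad]].
rewrite (form_radical_eq _ as_rad) bformC (form_radical_eq _ as_rad).
by rewrite gt_eqF// (finite_root_system_gt0 (lift_root_system L)).
Qed.

Lemma aniso_weight (K : realType) (V : vectType K) (B : {symmetric V})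
  (R S : set V) (a : V) : finite_lift B R S -> reduced_ears B R ->
  aniso_part B R a ->
  exists2 x, B x (coroot B a) = 1 &
    forall b, aniso_part B R b -> B x (coroot B b) \is a Num.int.
Proof.
move=> L Rred /(lift_aniso L)[s [Ss s0 sa]].
have [x xs xint] :=
  finite_root_weight (lift_root_system L) (lift_reduced L Rred) Ss s0.
exists x => [|b /(lift_aniso L)[t [St t0 tb]]].
  by rewrite (coroot_radical_eq _ sa).
by rewrite (coroot_radical_eq _ tb) xint.
Qed.

(** * The Weyl group acting on V *)

(** The hyperbolic extension contains V as a subspace on which W acts by the
    ordinary reflections of V; the whole proof takes place there. *)
Lemma ext_reflection_embed (K : realType) (V : vectType K) (B : {symmetric V})
  (D : {vspace V}) (a v : V) :
  ext_reflection B D a (ext_embed B v) = ext_embed B (reflection B a v).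
Proof.
have fE (u w : V) : ext_form D (ext_embed B u) (ext_embed B w) = B u w.
  by rewrite /ext_form /= !lfunE /= !addr0.
rewrite ext_reflectionE /reflection.
have -> : coroot (ext_form D (B:=B)) (ext_embed B a) = ext_embed B (coroot B a).
  by rewrite /coroot fE; congr pair; rewrite scaler0.
by rewrite fE; congr pair; rewrite /= scaler0 subr0.
Qed.

Lemma ext_reflectionK (K : realType) (V : vectType K) (B : {symmetric V})
  (D : {vspace V}) (a : V) : B a a != 0 ->
  (ext_reflection B D a \o ext_reflection B D a)%VF = \1%VF.
Proof.
move=> a0; apply/lfunP => x; rewrite comp_lfunE id_lfunE.
rewrite (ext_reflectionE D a x) /reflection linearB linearZ /=.
rewrite ext_reflection_embed.
rewrite ext_reflectionE /reflection.
have -> : ext_embed B (a - B a (coroot B a) *: a) = - ext_embed B a.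
  rewrite form_coroot_id// /ext_embed; congr pair; rewrite ?oppr0//.
  by rewrite scaler_nat mulr2n opprD addrA subrr sub0r.
by rewrite scalerN opprK subrK.
Qed.

(** The property carried through the group also speaks of the inverse, because
    mapping X into itself is not inherited by inverses when X is infinite;
    generators are involutions, so it costs nothing there. *)
Lemma weyl_group_stable (K : realType) (V : vectType K) (B : {symmetric V})
  (S P X : set V) (g : 'End(ext_space B)) (x : V) :
  (forall p, P p -> B p p != 0) ->
  (forall p y, P p -> X y -> X (reflection B p y)) ->
  weyl_group B S P g -> X x ->
  exists2 y, X y & g (ext_embed B x) = ext_embed B y.
Proof.
move=> Paniso PX Wg Xx.
pose stab (g : 'End(ext_space B)) :=
  forall x, X x -> exists2 y, X y & g (ext_embed B x) = ext_embed B y.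
pose G := [set g : 'End(ext_space B) |
  [/\ lker g = 0%VS, stab g & stab (g^-1)%VF]].
suff [_ /(_ _ Xx)] : G g by [].
have stab_comp h k : stab h -> stab k -> stab (h \o k)%VF.
  move=> hs ks y /ks[z /hs[t Xt ht] kz].
  by exists t => //; rewrite comp_lfunE kz ht.
have invE (h k : 'End(ext_space B)) : (k \o h)%VF = \1%VF ->
    lker h = 0%VS /\ (h^-1)%VF = k.
  move=> kh; have h0 : lker h == 0%VS.
    by apply/lker0P => u v e; rewrite -[u]id_lfunE -kh comp_lfunE e
      -comp_lfunE kh id_lfunE.
  by split; [exact/eqP | rewrite -[k](lker0_compfK h0) kh comp_lfun1l].
apply: smallest_sub Wg; first split.
- by move=> h [].
- have [k0 k1] := invE \1%VF \1%VF (comp_lfun1l _).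
  by split; rewrite ?k1// => y Xy; exists y; rewrite ?id_lfunE.
- move=> h k [/eqP h0 hs hs'] [/eqP k0 ks ks'].
  have [|l0 l1] := invE (h \o k)%VF (k^-1 \o h^-1)%VF.
    by rewrite comp_lfunA lker0_compfVK// lker0_compVf.
  by split; rewrite ?l1; auto.
- move=> h [/eqP h0 hs hs'].
  have [|l0 l1] := invE (h^-1)%VF h; first by rewrite lker0_compfV.
  by split; rewrite ?l1.
- move=> _ [p Pp <-].
  have [l0 l1] := invE _ _ (ext_reflectionK <<fset_set S>> (Paniso p Pp)).
  suff s : stab (ext_reflection B <<fset_set S>> p) by split; rewrite ?l1.
  move=> y Xy; exists (reflection B p y); first exact: PX.
  exact: ext_reflection_embed.
Qed.

Lemma ext_embed_inj (K : realType) (V : vectType K) (B : {symmetric V}) :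
  injective (ext_embed B).
Proof. by move=> u v []. Qed.

(** * The lattice spanned by P *)

Lemma zspan_sub (V : zmodType) (A H : set V) :
  additive_subgroup H -> A `<=` H -> zspan A `<=` H.
Proof. exact: smallest_sub. Qed.

Lemma zspan_gen (V : zmodType) (A : set V) : A `<=` zspan A.
Proof. exact: sub_gen_smallest. Qed.

Lemma zspan_subgroup (V : zmodType) (A : set V) : additive_subgroup (zspan A).
Proof.
split=> [H [[H0 _] _] //|x y Ax Ay H HA].
by have [[_ HB] _] := HA; apply: HB; [apply: Ax | apply: Ay].
Qed.

Lemma additive_subgroup_int (K : realType) (V : vectType K) (H : set V)
  (n : K) (v : V) : additive_subgroup H -> n \is a Num.int -> H v -> H (n *: v).
Proof.
move=> [H0 HB] /intrP[m ->] Hv; rewrite scaler_int.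
have HN u : H u -> H (- u) by move=> Hu; rewrite -sub0r; apply: HB.
have Hn k : H (v *+ k).
  by elim: k => // k IH; rewrite mulrS -[v *+ k]opprK;
    apply: HB => //; apply: HN.
by case: m => k; [exact: Hn | apply: HN; exact: Hn].
Qed.

(** The isotropic roots are differences of anisotropic ones, so only the latter
    have to be reached. *)
Lemma zspan_eq_of_aniso (K : realType) (V : vectType K) (B : {symmetric V})
  (R P : set V) : extended_affine_root_system B R -> P `<=` aniso_part B R ->
  aniso_part B R `<=` zspan P -> zspan P = zspan R.
Proof.
move=> E PR RP; apply/seteqP; split.
  apply: zspan_sub; first exact: zspan_subgroup.
  by move=> p /PR[Rp _]; apply: zspan_gen.
apply: zspan_sub; first exact: zspan_subgroup.
move=> r Rr; have [rr|nr] := pselect (iso_part B R r).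
  move: rr; rewrite (ears_iso E) => -[_ [a aR [b bR <-]]].
  by have [_] := zspan_subgroup P; apply; apply: RP.
exact: RP.
Qed.

Lemma zspan_int (K : realType) (V : vectType K) (B : {symmetric V})
  (R P : set V) (p v : V) : extended_affine_root_system B R ->
  P `<=` aniso_part B R -> P p -> zspan P v -> B v (coroot B p) \is a Num.int.
Proof.
move=> E PR Pp; move: v; apply: zspan_sub.
  split=> [|u w]; first by rewrite /= linear0l.
  by rewrite /= linearBl /= => *; apply: rpredB.
by move=> q Pq; apply: (ears_int E); apply: PR.
Qed.

(** For the weight x of [aniso_weight], the coset x + <P> is stable under the
    reflections in P, hence under W. It contains w_a x = x - a. *)
Lemma generating_zspan (K : realType) (V : vectType K) (B : {symmetric V})
  (R S P : set V) : extended_affine_root_system B R -> reduced_ears B R ->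
  finite_lift B R S -> P `<=` aniso_part B R -> generates_weyl B R S P ->
  aniso_part B R `<=` zspan P.
Proof.
move=> E Rred L PR gen a Ra.
have [x xa xint] := aniso_weight L Rred Ra.
have ZP := zspan_subgroup P.
have [||||y /= Zy ye] := @weyl_group_stable _ _ B S P
  [set y | zspan P (x - y)] (ext_reflection B <<fset_set S>> a) x.
- by move=> p /PR; apply: aniso_neq0 L.
- move=> p y Pp /= Zy; have [_ ZB] := ZP.
  rewrite /reflection opprB addrCA addrC -[X in _ + X]opprK -scaleNr.
  apply: ZB => //.
  apply: additive_subgroup_int (zspan_gen Pp) => //; rewrite rpredN.
  rewrite -[y](subKr x) linearBl /= rpredB//; first by apply: xint; apply: PR.
  exact: zspan_int PR Pp Zy.
- rewrite gen; apply: sub_gen_smallest; exact: imageP.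
- by rewrite /= subrr; case: ZP.
move: ye; rewrite ext_reflection_embed => /ext_embed_inj ye.
by move: Zy; rewrite -ye /reflection xa scale1r opprB addrCA subrr addr0.
Qed.

(** Integrality makes <P> itself stable under W_P, so it contains the
    orbit of P. *)
Lemma reflectable_zspan (K : realType) (V : vectType K) (B : {symmetric V})
  (R S P : set V) : extended_affine_root_system B R ->
  finite_lift B R S -> reflectable_base B R S P ->
  aniso_part B R `<=` zspan P.
Proof.
move=> E L [PR orb _] a Ra.
have : weyl_orbit B S P (ext_embed B a) by rewrite orb; exact: imageP.
move=> [g Wg [p Pp ge]].
have ZP := zspan_subgroup P.
have [|||y Zy] := @weyl_group_stable _ _ B S P (zspan P) g p _ _ Wg _.
- by move=> q /PR; apply: aniso_neq0 L.
- move=> q y Pq Zy; case: ZP (ZP) => _ + ZP; apply=> //.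
  by apply: additive_subgroup_int (zspan_gen Pq) => //; apply: zspan_int PR _ _.
- exact: zspan_gen.
by rewrite ge => /ext_embed_inj ->.
Qed.

(** * Connectedness of P *)

Definition perp (K : realType) (V : vectType K) (B : {symmetric V})
  (A : set V) : set V := [set v | forall a, A a -> B a v = 0].

(** P2 is contained in the orthogonal of P1, and P1 in its biorthogonal: a
    reflection in either part fixes one of these subspaces pointwise and adds to
    elements of the other a vector of that same subspace. *)
Lemma perp_reflection (K : realType) (V : vectType K) (B : {symmetric V})
  (P1 P2 : set V) (p y : V) : (forall a b, P1 a -> P2 b -> B a b = 0) ->
  (P1 `|` P2) p ->
  perp B P1 y -> perp B P1 (reflection B p y).
Proof.
move=> orth [] Pp oy a Pa; rewrite /reflection linearBr /= bformZr oy//.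
  by rewrite form_coroot (bformC B y) oy// mulr0 !mul0r subrr.
by rewrite (orth _ _ Pa Pp) mulr0 subrr.
Qed.

Lemma biperp_reflection (K : realType) (V : vectType K) (B : {symmetric V})
  (P1 P2 : set V) (p y : V) : (forall a b, P1 a -> P2 b -> B a b = 0) ->
  (P1 `|` P2) p ->
  perp B (perp B P1) y ->
  perp B (perp B P1) (reflection B p y).
Proof.
move=> orth [] Pp oy a oa; rewrite /reflection linearBr /= bformZr oy//.
  by rewrite (bformC B a) oa// mulr0 subrr.
have op : perp B P1 p by move=> b Pb; apply: orth.
by rewrite form_coroot (bformC B y) (oy _ op) mulr0 !mul0r subrr.
Qed.

(** If P1 and P2 disconnect P, then the roots orthogonal to P1 and the remaining
    ones disconnect the roots of R: by hypothesis, the latter lie in the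
    biorthogonal of P1. *)
Lemma connected_of_dichotomy (K : realType) (V : vectType K) (B : {symmetric V})
  (R S P : set V) : extended_affine_root_system B R ->
  finite_lift B R S -> P `<=` aniso_part B R ->
  (forall P1 P2, P = P1 `|` P2 -> (forall a b, P1 a -> P2 b -> B a b = 0) ->
    aniso_part B R `<=` perp B P1 `|` perp B (perp B P1)) ->
  connected_roots B P.
Proof.
move=> E L PR dich [P1 [P2 [[p Pp] [q Pq] PE _ orth]]].
have {}dich := dich P1 P2 PE orth; apply: (ears_connected E).
exists (aniso_part B R `\` perp B P1), (aniso_part B R `&` perp B P1).
split.
- exists p; split; first by apply: PR; rewrite PE; left.
  move=> /(_ p Pp) /eqP; apply/negP; apply: (aniso_neq0 L).
  by apply: PR; rewrite PE; left.
- by exists q; split=> [|a Pa]; [apply: PR; rewrite PE; right | apply: orth].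
- by rewrite setDE -setIUr setUC setUv setIT.
- by rewrite setDE setIACA setIid [~` _ `&` _]setIC setICr setI0.
- move=> a b [Ra na] [_ ob]; have [//|oo] := dich _ Ra.
  by rewrite bformC; apply: oo.
Qed.

(** Let p in P1 be not orthogonal to [a]. Then p and w_a p are both in the
    biorthogonal of P1, and their difference is a nonzero multiple of [a]. *)
Lemma generating_connected (K : realType) (V : vectType K) (B : {symmetric V})
  (R S P : set V) : extended_affine_root_system B R ->
  finite_lift B R S -> P `<=` aniso_part B R -> generates_weyl B R S P ->
  connected_roots B P.
Proof.
move=> E L PR gen; apply: (connected_of_dichotomy E L PR) => P1 P2 PE orth a Ra.
have aa := aniso_neq0 L Ra.
have [|na] := pselect (perp B P1 a); [by left | right].
have [p Pp pa] : exists2 p, P1 p & B p a != 0.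
  move/existsNP: na => [p /not_implyP[Pp /eqP pa]]; by exists p.
have [||||y oy] := @weyl_group_stable _ _ B S P
  (perp B (perp B P1)) (ext_reflection B <<fset_set S>> a) p.
- by move=> q /PR; apply: aniso_neq0 L.
- by move=> q y; rewrite PE; apply: biperp_reflection orth.
- rewrite gen; apply: sub_gen_smallest; exact: imageP.
- by move=> b ob; rewrite bformC; apply: ob.
rewrite ext_reflection_embed => /ext_embed_inj ye b ob.
move: (oy b ob); rewrite -ye /reflection linearBr /= bformZr (bformC B b p).
rewrite (ob _ Pp) sub0r => /eqP.
rewrite oppr_eq0 mulf_eq0 form_coroot !mulf_eq0 invr_eq0.
by rewrite (negPf pa) (negPf aa) pnatr_eq0 => /eqP.
Qed.

Lemma reflectable_connected (K : realType) (V : vectType K) (B : {symmetric V})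
  (R S P : set V) : extended_affine_root_system B R ->
  finite_lift B R S -> reflectable_base B R S P -> connected_roots B P.
Proof.
move=> E L [PR orb _].
apply: (connected_of_dichotomy E L PR) => P1 P2 PE orth a Ra.
have : weyl_orbit B S P (ext_embed B a) by rewrite orb; exact: imageP.
move=> [g Wg [p Pp ge]].
have Paniso q : P q -> B q q != 0 by move=> /PR; apply: aniso_neq0 L.
move: (Pp); rewrite PE => -[P1p|P2p].
- right; have [||y oy] := @weyl_group_stable _ _ B S P
    (perp B (perp B P1)) g p Paniso _ Wg.
  + by move=> q y; rewrite PE; apply: biperp_reflection orth.
  + by move=> b ob; rewrite bformC; apply: ob.
  by rewrite ge => /ext_embed_inj ->.
- left; have [||y oy] := @weyl_group_stable _ _ B S P
    (perp B P1) g p Paniso _ Wg.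
  + by move=> q y; rewrite PE; apply: perp_reflection orth.
  + by move=> b Pb; apply: orth.
  by rewrite ge => /ext_embed_inj ->.
Qed.

Theorem proposition3p1p5 (K : realType) (V : vectType K) (B : {symmetric V})
  (B_psd : forall v, 0 <= B v v) (R S : set V)
  (R_ears : extended_affine_root_system B R)
  (R_reduced : reduced_ears B R)
  (S_lift : finite_lift B R S) :
  (forall P : set V, P `<=` aniso_part B R -> generates_weyl B R S P ->
     zspan P = zspan R /\ connected_roots B P) /\
  (forall P : set V,
     minimum_generating B R S P \/ minimal_generating B R S P \/
       reflectable_base B R S P ->
     zspan P = zspan R /\ connected_roots B P).
Proof.
have main P : P `<=` aniso_part B R -> generates_weyl B R S P ->
    zspan P = zspan R /\ connected_roots B P.
  move=> PR gen; split; last exact: generating_connected gen.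
  apply: (zspan_eq_of_aniso R_ears PR).
  exact: generating_zspan R_ears R_reduced S_lift PR gen.
split=> // P [[PR gen _]|[[PR gen _]|base]]; [exact: main | exact: main |].
have [PR _ _] := base; split; last exact: reflectable_connected base.
apply: (zspan_eq_of_aniso R_ears PR).
exact: reflectable_zspan R_ears S_lift base.
Qed.
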